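(* For any finite set $\mathcal{A}\subset\mathbb{R}$ of size at least two, $\lceil\log_2(|\mathcal{A}|)\rceil\le C(\mathcal{A})\le|\mathcal{A}|-1$.
   Context: For a finite set $\mathcal{A}\subset\mathbb{R}$, the complexity $C(\mathcal{A})$ is the smallest positive integer $\theta$ for which there exist (not necessarily distinct) real numbers $x_1,\dots,x_\theta,y_1,\dots,y_\theta$ with $\mathcal{A}\subseteq\{x_1,y_1\}+\{x_2,y_2\}+\cdots+\{x_\theta,y_\theta\}$, where $+$ denotes the sumset $\mathcal{S}+\mathcal{T}=\{s+t\mid s\in\mathcal{S},t\in\mathcal{T}\}$. *)

(* Defs.v *)
From HB Require Import structures.
From mathcomp Require Import all_boot all_order all_algebra.
From mathcomp Require Import finmap.
From mathcomp Require Import boolp reals exp.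

Set Implicit Arguments.
Unset Strict Implicit.
Unset Printing Implicit Defensive.

Import Order.TTheory GRing.Theory Num.Theory.

Local Open Scope fset_scope.
Local Open Scope ring_scope.

Definition sumset (R : realType) (S T : {fset R}) : {fset R} :=
  [fset s + t | s in S, t in T].

(* Since sumset is associative with neutral element [fset 0], the iterated
   operator is {x_0, y_0} + ... + {x_(theta-1), y_(theta-1)} when 0 < theta. *)
Definition covered (R : realType) (A : {fset R}) (theta : nat) : Prop :=
  exists x y : 'I_theta -> R,
    A `<=` \big[@sumset R/[fset 0]]_(i < theta) [fset x i; y i].

Lemma sumsetP (R : realType) (S T : {fset R}) (u : R) :
  reflect (exists s t, [/\ s \in S, t \in T & u = s + t])
          (u \in sumset S T).
Proof.
apply: (iffP (imfset2P _ _ _ _ _)) => [[s sS [t tT ->]]|[s [t [sS tT ->]]]].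
  by exists s, t; split.
by exists s => //; exists t.
Qed.

Lemma ex_covered (R : realType) (A : {fset R}) :
  exists theta : nat, (0 < theta)%N && `[< covered A theta >].
Proof.
suff H (s : seq R) : exists x y : 'I_(size s) -> R, {subset 0 :: s <=
    \big[@sumset R/[fset 0]]_(i < size s) [fset x i; y i]}.
  exists (size (0 :: enum_fset A)); apply/asboolP.
  have [x [y xy]] := H (0 :: enum_fset A); exists x, y.
  by apply/fsubsetP => a aA; apply: xy; rewrite !inE [a \in enum_fset A]aA !orbT.
elim: s => [|a s [x [y xy]]].
  by exists (fun=> 0), (fun=> 0) => u; rewrite big_ord0 !inE.
exists (fun i => if unlift ord0 i is Some j then x j else 0).
exists (fun i => if unlift ord0 i is Some j then y j else a).
move=> u ucs; rewrite big_ord_recl unlift_none.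
under eq_bigr do rewrite liftK.
apply/sumsetP; move: ucs; rewrite !inE orbCA => /orP[/eqP ->|us].
  by exists a, 0; split; rewrite ?inE ?eqxx ?orbT ?addr0 ?xy ?mem_head.
by exists 0, u; split; rewrite ?inE ?eqxx ?add0r ?xy// inE.
Qed.

Definition complexity (R : realType) (A : {fset R}) : nat :=
  ex_minn (ex_covered A).

Definition log2 (R : realType) (x : R) : R := ln x / ln 2.

(* Main.v *)
(* A sumset of theta pairs has at most 2 ^ theta elements. Conversely, for
   A = {a, b, c_1, ..., c_m} the m + 1 pairs {0, c_i - a} and {a, b} suffice:
   choosing 0 in all but at most one of the pairs {0, c_i - a} and completing
   by a or b yields every element of A. *)

Require Import Defs.
From mathcomp Require Import all_boot all_order all_algebra.
From mathcomp Require Import finmap.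
From mathcomp Require Import boolp reals exp.

Import Order.TTheory GRing.Theory Num.Theory.

Local Open Scope fset_scope.
Local Open Scope ring_scope.

Lemma leq_card_sumset (R : realType) (S T : {fset R}) :
  (#|` sumset S T| <= #|` S| * #|` T|)%N.
Proof.
rewrite -(size_allpairs +%R); apply: uniq_leq_size => // u.
by case/sumsetP => s [t [sS tT ->]]; exact: allpairs_f.
Qed.

Lemma card_covered (R : realType) (A : {fset R}) (theta : nat) :
  covered A theta -> (#|` A| <= 2 ^ theta)%N.
Proof.
case=> x [y /fsubset_leq_card/leq_trans]; apply.
(* The empty iterated sumset is {0}, of size 1 = 2 ^ 0; each further pair at most doubles the
   size. *)
elim: theta x y => [|theta IH] x y; first by rewrite big_ord0 cardfs1.
rewrite big_ord_recl expnS (leq_trans (leq_card_sumset _ _ _))//.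
by rewrite leq_mul ?IH// cardfs2; case: (_ != _).
Qed.

(** The list form lets induction on [s] run: [[:: a; b]] takes one pair and each further entry one
    more. *)
Lemma covered_cons2 (R : realType) (A : {fset R}) (a b : R) (s : seq R) :
  {subset A <= [:: a, b & s]} -> covered A (size s).+1.
Proof.
suff [x [y xy]] : exists x y : 'I_(size s).+1 -> R, {subset [:: a, b & s] <=
    \big[@sumset R/[fset 0]]_(i < (size s).+1) [fset x i; y i]}.
  by move=> As; exists x, y; apply/fsubsetP => u /As/xy.
elim: s => [|c s [x [y xy]]].
  exists (fun=> a), (fun=> b) => u; rewrite big_ord_recl big_ord0 !inE => uab.
  by apply/sumsetP; exists u, 0; rewrite !inE addr0.
(* The new pair {0, c - a} sits at index [ord0]; [unlift] sends the other indices to the earlier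
   pairs. *)
exists (fun i => oapp x 0 (unlift ord0 i)).
exists (fun i => oapp y (c - a) (unlift ord0 i)).
move=> u ucs; rewrite big_ord_recl unlift_none.
under eq_bigr do rewrite liftK.
(* The entry c is (c - a) + a, with a already reached by the earlier pairs; any other u is 0 + u. *)
apply/sumsetP; have [->|uc] := eqVneq u c.
  by exists (c - a), a; rewrite !inE eqxx orbT subrK xy ?mem_head.
exists 0, u; rewrite !inE eqxx add0r xy//.
by move: ucs; rewrite !inE (negPf uc).
Qed.

Lemma ceil_log2_le (R : realType) (n k : nat) :
  (0 < n)%N -> (n <= 2 ^ k)%N -> Num.ceil (log2 (n%:R : R)) <= k%:Z.
Proof.
move=> n0 nk; have ln2_gt0 : 0 < ln 2 :> R by rewrite ln_gt0 ?ltr1n.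
rewrite ceil_le_int /log2 ler_pdivrMr// mulr_natl -lnXn// ler_ln ?posrE ?exprn_gt0 ?ltr0n//.
by rewrite -natrX ler_nat.
Qed.

Theorem lemma1 (R : realType) (A : {fset R}) (hA : (2 <= #|` A|)%N) :
  Num.ceil (log2 (#|` A|%:R : R)) <= (complexity A)%:Z <= #|` A|%:Z - 1.
Proof.
rewrite /complexity; case: ex_minnP => theta /andP[_ /asboolP cA] min_theta.
rewrite ceil_log2_le ?(ltnW hA) ?card_covered//=.
have [a [b [s defA]]] : exists a b s, enum_fset A = [:: a, b & s].
  by case: (enum_fset A) hA => [|a [|b s]]// _; exists a, b, s.
have sizeA : #|` A| = (size s).+2 by rewrite cardfE -cardfE /= defA.
(* Here |A| - 1 is [(size s).+1], so by minimality of [theta] a cover by that many pairs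
   suffices. *)
rewrite sizeA intS addrC addKr lez_nat; apply: min_theta; apply/asboolP.
by apply: (@covered_cons2 _ _ a b) => u; rewrite -defA.
Qed.
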